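(* Let $m,n,k$ be positive integers with $3\leq m\leq n$ and $3\leq k\leq n$. Then there exists a signed magic rectangle $SMR(m,n;k,3)$ if and only if $mk=3n$.
   Context: For positive integers $m,n,r,s$, a signed magic rectangle $SMR(m,n;r,s)$ is an $m\times n$ array (cells may be empty) with entries from $X$, where $X=\{0,\pm1,\pm2,\ldots,\pm(mr-1)/2\}$ if $mr$ is odd and $X=\{\pm1,\pm2,\ldots,\pm mr/2\}$ if $mr$ is even, such that precisely $r$ cells in every row and precisely $s$ cells in every column are filled, every integer of $X$ appears exactly once in the array, and the sum of each row and of each column is zero. *)

(* Defs.v *)
From mathcomp Require Import all_boot all_order all_algebra.

Set Implicit Arguments.
Unset Strict Implicit.
Unset Printing Implicit Defensive.

Import Order.TTheory GRing.Theory Num.Theory.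
Local Open Scope ring_scope.

Definition smr_entries (m r : nat) : pred int :=
  fun z => if odd (m * r) then (`|z| <= ((m * r).-1)./2)%N
           else (0 < `|z| <= (m * r)./2)%N.

(* In an m x n array, [None] is an empty cell; empty cells count as 0 in row
   and column sums. *)
Definition is_SMR (m n r s : nat) (A : 'M[option int]_(m, n)) : Prop :=
  [/\ (forall i j z, A i j = Some z -> smr_entries m r z),
      (forall z, smr_entries m r z ->
         #|[set ij : 'I_m * 'I_n | A ij.1 ij.2 == Some z]| = 1%N),
      (forall i, #|[set j | A i j != None]| = r) /\
      (forall j, #|[set i | A i j != None]| = s),
      (forall i, \sum_j odflt 0 (A i j) = 0) &
      (forall j, \sum_i odflt 0 (A i j) = 0)].

Definition exists_SMR (m n r s : nat) : Prop :=
  exists A : 'M[option int]_(m, n), is_SMR r s A.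

(* Main.v *)
Require Import Defs.
From mathcomp Require Import all_boot all_order all_algebra.
From mathcomp Require Import zify ring.

Set Implicit Arguments.
Unset Strict Implicit.
Unset Printing Implicit Defensive.

Import Order.TTheory GRing.Theory Num.Theory.

(** The condition [m * k = 3 * n] is necessary because both sides count the
    filled cells.  For the converse, a rectangle amounts to two partitions of
    the set X of entries into zero-sum parts, [m] rows of size [k] and [n]
    columns of size 3, such that a row and a column share at most one entry
    ([SMR_of_cells]).

    The columns come from circuits ([SMR_of_circuit]).  Let [nxt] be a
    permutation of a set of [n] vertices, numbered by 1, ..., n through [c],
    and let [b = n / 2].  Each vertex [i] carries the zero-sum triple
    [c i - b - n - 1], [n + 1 - c i - c (nxt i)], [c (nxt i) + b], whose members
    lie in the lower, middle and upper third of X.  As soon as the numbers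
    [c i + c (nxt i)] are pairwise distinct the triples partition X.  The lower
    entry of the triple of [i], the middle entry of the triple before it and
    the upper entry of the one before that also add up to 0: these are the
    columns.  Whole triples meet each column at most once, so they can be merged
    into rows as long as neighbouring triples stay apart, and they can also be
    dismantled into opposite pairs [x], [- x].

    If 3 divides [k], then [n = m * t], and an explicit single circuit
    ([cyc_pos]) whose triples are dealt to the rows modulo [m] does it
    ([SMR_cyclic]).

    Otherwise 3 divides [m], say [m = 3 * a] and [n = a * k].  If X has an even
    number of elements, then [n = 2 * p] and a circuit is chosen that is
    invariant under negation: its vertices are pairs of a sign and a position
    below [p], and changing the sign reflects the number [c] ([zigzag]).  The
    positions are cut into blocks of consecutive positions with rows of their
    own ([SMR_of_blocks]): for even [k], blocks of length [k / 2] have three rows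
    made of opposite pairs ([SMR_paired]); for odd [k], blocks of length [k]
    have six rows, which mix whole triples with a pattern of four or five
    positions ([SMR_six_rows]).

    If X has an odd number of elements, [a] and [k] are odd.  A 3 by [k] rectangle
    is built from a Kotzig array ([three_rows], and three small tables), and
    every entry is blown up into [a] entries, again by Kotzig arrays
    ([SMR_blow_up]). *)

(** * Rectangles from families of labelled cells *)


Section Cells.
Local Open Scope ring_scope.

Lemma SMR_count m n r s : exists_SMR m n r s -> (m * r = n * s)%N.
Proof.
move=> [A [_ _ [rowA colA] _ _]].
have swap : (\sum_i #|[set j | A i j != None]| =
             \sum_j #|[set i | A i j != None]|)%N.
  under eq_bigr do rewrite cardsE -sum1_card.
  under [RHS]eq_bigr do rewrite cardsE -sum1_card.
  rewrite (exchange_big_dep predT) //=.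
move: swap; under eq_bigr do rewrite rowA; under [in RHS]eq_bigr do rewrite colA.
by rewrite !sum_nat_const !card_ord.
Qed.

Definition entry_seq N : seq int :=
  if odd N then [seq i%:Z - N./2%:Z | i <- iota 0 N]
  else [seq i.+1%:Z | i <- iota 0 N./2] ++ [seq - i.+1%:Z | i <- iota 0 N./2].

Lemma size_entry_seq N : size (entry_seq N) = N.
Proof.
rewrite /entry_seq; case: ifP => oddN; rewrite ?size_cat !size_map !size_iota //.
lia.
Qed.

Lemma mem_entry_seq m r z : smr_entries m r z -> z \in entry_seq (m * r).
Proof.
rewrite /smr_entries /entry_seq; case: ifP => oddN Hz.
  apply/mapP; exists (absz (z + (m * r)./2%:Z)); last by lia.
  by rewrite mem_iota; lia.
rewrite mem_cat; apply/orP; case: (leP 0 z) => z0; [left|right].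
  by apply/mapP; exists (absz z).-1; [rewrite mem_iota|]; lia.
by apply/mapP; exists (absz z).-1; [rewrite mem_iota|]; lia.
Qed.

(** Every admissible entry occurs by counting: the cells are as numerous as the
    admissible entries, and [val] is injective. *)
Lemma SMR_of_cells (I RT CT : finType) m n r s (row : I -> RT) (col : I -> CT)
    (val : I -> int) :
    #|RT| = m -> #|CT| = n ->
    (forall x y, row x = row y -> col x = col y -> x = y) ->
    injective val ->
    (forall x, smr_entries m r (val x)) ->
    (forall i, \sum_x (row x == i : nat) = r)%N ->
    (forall j, \sum_x (col x == j : nat) = s)%N ->
    (forall i, \sum_(x | row x == i) val x = 0) ->
    (forall j, \sum_(x | col x == j) val x = 0) ->
  exists_SMR m n r s.
Proof.
move=> <- <- inj_rc inj_val val_entry row_size col_size row_sum col_sum.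
pose at_cell (i : 'I_#|RT|) (j : 'I_#|CT|) x :=
  (row x == enum_val i) && (col x == enum_val j).
pose A := \matrix_(i, j) omap val [pick x | at_cell i j x].
have at_uniq i j x y : at_cell i j x -> at_cell i j y -> x = y.
  move=> /andP[/eqP rx /eqP cx] /andP[/eqP ry /eqP cy].
  by apply: inj_rc; rewrite ?rx ?ry ?cx ?cy.
have AE i j x : at_cell i j x -> A i j = Some (val x).
  rewrite mxE; case: pickP => [y aty atx|no]; last by rewrite no.
  by rewrite (at_uniq _ _ _ _ aty atx).
have AP i j z : A i j = Some z -> exists2 x, at_cell i j x & val x = z.
  rewrite mxE; case: pickP => [x atx [<-]|_ //]; by exists x.
have at_pos x : at_cell (enum_rank (row x)) (enum_rank (col x)) x.
  by rewrite /at_cell !enum_rankK !eqxx.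
have odfltA i j : odflt 0 (A i j) = \sum_(x | at_cell i j x) val x.
  rewrite mxE; case: pickP => [x atx|no] /=; last by rewrite big_pred0.
  rewrite (big_pred1 x) // => y.
  by apply/idP/eqP => [aty|-> //]; apply: at_uniq aty atx.
have filledA i j : (A i j != None) = (\sum_x (at_cell i j x : nat))%N :> nat.
  rewrite mxE; case: pickP => [x atx|no] /=.
    rewrite (bigD1 x) //= atx big1 // => y neq_yx.
    by case aty: (at_cell i j y) => //; rewrite (at_uniq _ _ _ _ aty atx) eqxx in neq_yx.
  by rewrite big1 // => x _; rewrite no.
have card_filled (T : finType) (P : pred T) : (#|[set t | P t]| = \sum_t (P t : nat))%N.
  by rewrite -sum1dep_card big_mkcond /=; apply: eq_bigr => t _; case: (P t).
have sum_col (i : 'I_#|RT|) x :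
    (\sum_j (at_cell i j x : nat) = (row x == enum_val i))%N.
  rewrite (bigD1 (enum_rank (col x))) //= {1}/at_cell enum_rankK eqxx andbT.
  rewrite big1 ?addn0 // => j; apply: contraNeq; rewrite eqb0 negbK.
  by move=> /andP[_ /eqP ->]; rewrite enum_valK.
have sum_row (j : 'I_#|CT|) x :
    (\sum_i (at_cell i j x : nat) = (col x == enum_val j))%N.
  rewrite (bigD1 (enum_rank (row x))) //= {1}/at_cell enum_rankK eqxx.
  rewrite big1 ?addn0 // => i; apply: contraNeq; rewrite eqb0 negbK.
  by move=> /andP[/eqP -> _]; rewrite enum_valK.
have cardI : #|I| = (#|RT| * r)%N.
  rewrite -sum1_card -sum_nat_const -(eq_bigr _ (fun i _ => row_size i)).
  rewrite exchange_big /=; apply: eq_bigr => x _.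
  by rewrite (bigD1 (row x)) //= eqxx big1 // => i /negPf; rewrite eq_sym => ->.
exists A; split.
- by move=> i j z /AP[x _ <-].
- move=> z zX.
  have [x <-] : exists x, val x = z.
    have sub : {subset codom val <= entry_seq (#|RT| * r)}.
      by move=> _ /codomP[x ->]; apply: mem_entry_seq.
    have uniq_val : uniq (codom val) by rewrite map_inj_uniq ?enum_uniq.
    have [|_ eqX] := uniq_min_size uniq_val sub.
      by rewrite size_entry_seq size_codom cardI.
    have /codomP[x ->] : z \in codom val by rewrite eqX; apply: mem_entry_seq.
    by exists x.
  apply/eqP/cards1P; exists (enum_rank (row x), enum_rank (col x)).
  apply/setP => -[i j]; rewrite !inE /=; apply/eqP/eqP => [|[-> ->]].
    by move=> /AP[y /andP[/eqP ry /eqP cy] /inj_val xy];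
       rewrite -xy ry cy !enum_valK.
  exact: AE.
- split=> [i|j]; rewrite card_filled; under eq_bigr do rewrite filledA.
    rewrite exchange_big /= -(row_size (enum_val i)).
    by apply: eq_bigr => x _; rewrite sum_col.
  rewrite exchange_big /= -(col_size (enum_val j)).
  by apply: eq_bigr => x _; rewrite sum_row.
- move=> i; under eq_bigr do rewrite odfltA big_mkcond /=.
  rewrite exchange_big /= -[RHS](row_sum (enum_val i)) [RHS]big_mkcond.
  apply: eq_bigr => x _; rewrite -big_mkcond sumr_const.
  by rewrite -sum1_card big_mkcond sum_col; case: eqP.
- move=> j; under eq_bigr do rewrite odfltA big_mkcond /=.
  rewrite exchange_big /= -[RHS](col_sum (enum_val j)) [RHS]big_mkcond.
  apply: eq_bigr => x _; rewrite -big_mkcond sumr_const.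
  by rewrite -sum1_card big_mkcond sum_row; case: eqP.
Qed.

End Cells.

(** * Circuits *)

Section Circuit.
Local Open Scope ring_scope.

(** The triple of a vertex numbered [x] whose successor is numbered [y]. *)
Definition link_val (n : nat) (x y : int) (d : nat) : int :=
  match d with
  | 0 => x - n./2%:Z - n%:Z - 1
  | 1 => n%:Z + 1 - x - y
  | _ => y + n./2%:Z
  end.

Lemma link_val_sum n x y :
  link_val n x y 0 + link_val n x y 1 + link_val n x y 2 = 0.
Proof. rewrite /link_val; ring. Qed.

(** The entry [d] of the triple of [i] is put in column [iter d nxt i].  Column
    [j] then receives [c j - b - n - 1] from [j], [n + 1 - c i - c j] from the
    predecessor [i] of [j], and [c i + b] from the predecessor of [i], which
    cancel.  The bound on [c i + c (nxt i) - n - 1] keeps the middle entries away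
    from the outer ones; they are the only entries that may vanish, which is
    allowed for odd [n] only. *)
Lemma SMR_of_circuit (J RT : finType) m n k (nxt : J -> J) (c : J -> int)
    (row : J -> nat -> RT) :
    #|RT| = m -> #|J| = n -> (m * k = 3 * n)%N ->
    injective nxt -> injective c ->
    (forall i, 1 <= c i <= n%:Z) ->
    injective (fun i => c i + c (nxt i)) ->
    (forall i, - n./2%:Z <= c i + c (nxt i) - n%:Z - 1 <= n./2%:Z) ->
    (forall i, c i + c (nxt i) = n%:Z + 1 -> odd n) ->
    (forall i j d e, (d < 3)%N -> (e < 3)%N -> row i d = row j e ->
       iter d nxt i = iter e nxt j -> d = e) ->
    (forall r, \sum_i \sum_(d < 3) (row i d == r : nat) = k)%N ->
    (forall r, \sum_i \sum_(d < 3)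
       (if row i d == r then link_val n (c i) (c (nxt i)) d else 0) = 0) ->
  exists_SMR m n k 3.
Proof.
move=> cardR cardJ mk3n inj_nxt inj_c c_range inj_S S_range S_odd transv.
move=> row_size row_sum.
have inj_iter d : injective (iter d nxt) by elim: d => // d IHd x y /inj_nxt/IHd.
have [prv prvK nxtK] := injF_bij inj_nxt.
pose val (x : J * 'I_3) := link_val n (c x.1) (c (nxt x.1)) x.2.
apply: (@SMR_of_cells (J * 'I_3)%type RT J m n k 3 (fun x => row x.1 x.2)
          (fun x => iter x.2 nxt x.1) val) => //.
- move=> [i d] [j e] /= rij cij.
  have de : d = e by apply/val_inj/(transv _ _ _ _ _ _ rij cij).
  by move: cij; rewrite de => /inj_iter ->.
- have pos i := c_range i.
  move=> [i [[|[|[|//]]] ?]] [j [[|[|[|//]]] ?]]; rewrite /val /=;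
    move: (pos i) (pos j) (pos (nxt i)) (pos (nxt j)) (S_range i) (S_range j);
    move=> pi pj pi' pj' Si Sj E.
  all: try by exfalso; lia.
  + have /inj_c -> : c i = c j by lia.
    by congr (_, _); apply: val_inj.
  + have /inj_S -> : c i + c (nxt i) = c j + c (nxt j) by lia.
    by congr (_, _); apply: val_inj.
  + have /inj_c/inj_nxt -> : c (nxt i) = c (nxt j) by lia.
    by congr (_, _); apply: val_inj.
- move=> [i d]; rewrite /smr_entries mk3n oddM /= /val /=.
  move: (c_range i) (c_range (nxt i)) (S_range i) (@S_odd i).
  by case: d => [[|[|[|//]]] ?] /= *; case: ifP => oddn; lia.
- by move=> r; rewrite -(pair_bigA _ (fun i (d : 'I_3) => (row i d == r) : nat)) /=.
- move=> j; rewrite -(pair_bigA _ (fun i (d : 'I_3) => (iter d nxt i == j) : nat)) /=.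
  rewrite exchange_big /= -[RHS]card_ord -sum1_card; apply: eq_bigr => d _.
  have [i _ <-] : exists2 i, true & iter d nxt i = j.
    by exists (iter d prv j) => //; elim: (d : nat) j => // e IHe j;
      rewrite iterSr iterS ?nxtK // -iterS iterSr.
  rewrite (bigD1 i) //= eqxx big1 // => x.
  by apply: contraNeq; rewrite eqb0 negbK => /eqP/inj_iter ->.
- move=> r; rewrite big_mkcond /= -[RHS](row_sum r).
  by rewrite (pair_bigA _ (fun i (d : 'I_3) => if row i d == r then _ else 0)).
- move=> j; rewrite big_mkcond /=.
  rewrite -(pair_bigA _ (fun i (d : 'I_3) => if iter d nxt i == j then val (i, d) else 0)) /=.
  rewrite exchange_big /= !big_ord_recl big_ord0 /= addr0.
  have fiber d i (F : J -> int) : iter d nxt i = j ->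
      \sum_x (if iter d nxt x == j then F x else 0) = F i.
    move=> <-; rewrite -big_mkcond (big_pred1 i) // => x.
    by apply/eqP/eqP => [/inj_iter|->].
  rewrite (fiber 0%N j) // (fiber 1%N (prv j)) ?(fiber 2%N (prv (prv j))) //=.
  - by rewrite /val /= !nxtK; ring.
  - by rewrite !nxtK.
Qed.

End Circuit.

(** * A single circuit through all columns *)

(** The numbering of the vertices 0, ..., n - 1 of an [n]-cycle, two interleaved
    progressions.  For odd [n] both have step -1, so that the sum of two
    neighbours decreases by 1 at each step.  For even [n] that sum must avoid
    [n + 1] and has to be interrupted; this is done by a wrap-around of one
    progression when [n / 2] is even, and by one displaced vertex, at position
    [n / 2 - 1], when [n / 2] is odd. *)
Definition cyc_pos (n j : nat) : nat :=
  let s := j./2 in let h := n./2./2 in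
  if odd n then if odd j then n - s else n./2.+1 - s
  else if odd n./2 then
    if odd j then if s <= h then s.+1 else s.+2
    else if s < h then 2 * h + 3 + s else if s == h then h + 2 else 2 * h + 2 + s
  else if odd j then if s < h then h - s else 5 * h - s
  else 3 * h - s.

(** The closed form of [cyc_pos n j + cyc_pos n (j + 1) - (n + 1)], indices being
    taken modulo [n]. *)
Definition cyc_link (n j : nat) : int :=
  let h := n./2./2 in
  (if odd n then n./2%:Z - j%:Z
  else if odd n./2 then
    if (j + 2 <= 2 * h)%N then j%:Z - (2 * h)%:Z + 1
    else if (j + 1 == 2 * h)%N then - (2 * h)%:Z - 1
    else if (j == 2 * h)%N then - (2 * h)%:Z
    else if (j == 2 * h + 1)%N then 1
    else if (j + 1 == n)%N then 2
    else j%:Z - (2 * h)%:Z + 1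
  else if (j < n./2)%N then - 1 - j%:Z
  else if (j.+1 == n)%N then n./2%:Z
  else n%:Z - 1 - j%:Z)%R.

Lemma cyc_pos_range n j : j < n -> 0 < cyc_pos n j <= n.
Proof. by rewrite /cyc_pos => jn; do ?[case: ifP => ?]; lia. Qed.

Lemma cyc_pos_inj n i j : i < n -> j < n -> cyc_pos n i = cyc_pos n j -> i = j.
Proof.
rewrite /cyc_pos => ltin ltjn.
case: (boolP (odd n)) => on; last case: (boolP (odd n./2)) => oh;
by do ?[case: ifP => ?]; lia.
Qed.

Lemma cyc_linkE n j : 2 < n -> j < n ->
  ((cyc_pos n j)%:Z + (cyc_pos n (j.+1 %% n))%:Z = n%:Z + 1 + cyc_link n j)%R.
Proof.
move=> n_gt2 ltjn; have [jn|jn] : j.+1 = n \/ j.+1 < n by lia.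
  rewrite jn modnn /cyc_pos /cyc_link /=.
  case: (boolP (odd n)) => on; last case: (boolP (odd n./2)) => oh;
  by do ?[case: ifP => ?]; lia.
rewrite modn_small // /cyc_pos /cyc_link.
case: (boolP (odd n)) => on; last case: (boolP (odd n./2)) => oh;
by do ?[case: ifP => ?]; lia.
Qed.

Lemma cyc_link_range n j : 2 < n -> j < n ->
  (- n./2%:Z <= cyc_link n j <= n./2%:Z)%R.
Proof. by rewrite /cyc_link => n_gt2 ltjn; do ?[case: ifP => ?]; lia. Qed.

Lemma cyc_link_inj n i j : 2 < n -> i < n -> j < n ->
  cyc_link n i = cyc_link n j -> i = j.
Proof.
rewrite /cyc_link => n_gt2 ltin ltjn.
case: (boolP (odd n)) => on; last case: (boolP (odd n./2)) => oh;
by do ?[case: ifP => ?]; lia.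
Qed.

Lemma cyc_link_eq0 n j : 2 < n -> j < n -> cyc_link n j = 0%R -> odd n.
Proof. by rewrite /cyc_link => n_gt2 ltjn; do ?[case: ifP => ?]; lia. Qed.

(** * Rows of triples: the case where 3 divides k *)

Lemma sum_blocks (V : nmodType) a h (F : nat -> V) :
  (\sum_(j < a * h) F j = \sum_(l < a) \sum_(i < h) F (l * h + i)%N)%R.
Proof.
elim: a => [|a IHa]; first by rewrite !big_ord0.
by rewrite mulSnr big_split_ord IHa big_ord_recr.
Qed.

(** Triple [i] meets the columns [i], [i + 1], [i + 2] and goes to row
    [i mod m].  Two triples of a row are at distance at least [m >= 3] around the
    cycle, because [m] divides its length. *)
Lemma SMR_cyclic m t : 2 < m -> 0 < t -> exists_SMR m (m * t) (3 * t) 3.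
Proof.
move=> m_gt2 t_gt0; set n := m * t; have n_gt2 : 2 < n by rewrite /n; nia.
have m_gt0 : 0 < m by lia.
pose row (i : 'I_n) (d : nat) := Ordinal (ltn_pmod i m_gt0).
have nE (i : 'I_n) : ordS i = i.+1 %% n :> nat by [].
have linkE (i : 'I_n) : ((cyc_pos n i)%:Z + (cyc_pos n (ordS i))%:Z
                         = n%:Z + 1 + cyc_link n i)%R.
  by rewrite nE; apply: cyc_linkE.
have iterE d (i : 'I_n) : iter d (@ordS n) i = (i + d) %% n :> nat.
  elim: d => [|d IHd] /=; first by rewrite addn0 modn_small.
  by rewrite IHd addnS -addn1 modnDml addn1.
apply: (@SMR_of_circuit 'I_n 'I_m m n (3 * t) (@ordS n)
          (fun i => (cyc_pos n i)%:Z%R) row).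
- exact: card_ord.
- exact: card_ord.
- by rewrite /n; lia.
- exact: ordS_inj.
- by move=> i j [] /cyc_pos_inj eq_ij; apply/val_inj/eq_ij.
- by move=> i; have := cyc_pos_range (ltn_ord i); lia.
- move=> i j /=; rewrite !linkE => /addrI eq_link.
  exact/val_inj/(cyc_link_inj n_gt2 (ltn_ord i) (ltn_ord j)).
- by move=> i; rewrite linkE; have := cyc_link_range n_gt2 (ltn_ord i); lia.
- by move=> i; rewrite linkE => eq0; apply: (@cyc_link_eq0 n i) => //; lia.
- move=> i j d e d3 e3 /(congr1 val)/= rij /(congr1 (@nat_of_ord n)).
  rewrite !iterE => /(congr1 (modn^~ m)).
  rewrite !modn_dvdm ?dvdn_mulr // -modnDml rij modnDml => /eqP.
  by rewrite eqn_modDl !modn_small; [move=> /eqP | lia | lia].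
- move=> r; under eq_bigr do rewrite sum_nat_const card_ord.
  rewrite -big_distrr /=; congr (3 * _).
  transitivity (\sum_(i < n) (i %% m == r : nat)); first exact: eq_bigr.
  rewrite /n mulnC (@sum_blocks nat t m (fun i => (i %% m == r) : nat)).
  rewrite -[RHS]card_ord -sum1_card; apply: eq_bigr => l _.
  rewrite (bigD1 r) //= modnMDl modn_small // eqxx big1 // => i.
  apply: contraNeq; rewrite eqb0 negbK modnMDl modn_small //.
- move=> r; apply: big1 => i _; rewrite -big_mkcond /=.
  have [ri|ri] := eqVneq (row i 0) r; last by rewrite big_pred0 // => d; apply/negPf.
  rewrite (eq_bigl predT) => [|d]; last exact/eqP.
  by rewrite !big_ord_recl big_ord0 /= addr0 addrA link_val_sum.
Qed.

(** * Circuits invariant under negation *)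

Lemma sum_block (V : nmodType) a h l (F : nat -> nat -> nat -> V) : l < a ->
  (forall l' i j, l' != l -> F l' i j = 0%R) ->
  (\sum_(j < a * h) F (j %/ h)%N (j %% h)%N j = \sum_(i < h) F l i (l * h + i)%N)%R.
Proof.
move=> ltla F0; rewrite (@sum_blocks V a h (fun j => F (j %/ h) (j %% h) j)).
case: h => [|h]; first by rewrite big_ord0 big1 // => l' _; rewrite big_ord0.
have E l' i : i < h.+1 ->
    F ((l' * h.+1 + i) %/ h.+1) ((l' * h.+1 + i) %% h.+1) (l' * h.+1 + i)
    = F l' i (l' * h.+1 + i).
  by move=> lti; rewrite divnMDl // divn_small // addn0 modnMDl modn_small.
rewrite (bigD1 (Ordinal ltla)) //= [X in (_ + X)%R]big1 ?addr0.
  by apply: eq_bigr => i _; rewrite E.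
by move=> l' neq_l; rewrite big1 // => i _; rewrite E // F0.
Qed.

(** Twice the signed distance from [zigzag p j] to the centre of 1, ..., 2p is, up
    to sign, the graceful zigzag 1, 2p - 1, 3, 2p - 3, ..., in which neighbours
    differ by 2(p - 1), 2(p - 2), ....  Up to position [2 * l], with
    [l = (p - 1) / 4], the signs alternate, starting with a plus; from there on
    they are the opposite ones.  At that point the difference 2(p - 1 - 2l) gives
    way to the sum 2p, and the choice of [l] makes p - 1 - 2l, the one link that
    is then missing, appear between the last position and the first one or its
    reflection.  Position [p] stands for that end point. *)
Definition zigzag (p j : nat) : nat :=
  if j == p then if p %% 4 < 2 then p.+1 else p
  else if j <= 2 * (p.-1 %/ 4) then if odd j then j./2.+1 else p.+1 + j./2
  else if odd j then 2 * p - j./2 else p - j./2.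

(** The closed form of [zigzag p j + zigzag p (j + 1) - (2 * p + 1)]. *)
Definition zigzag_link (p j : nat) : int :=
  (let l := (p.-1 %/ 4)%N in
  if (j < 2 * l)%N then j%:Z + 1 - p%:Z
  else if j == (2 * l)%N then p%:Z
  else if j.+1 == p then
    if odd p then (2 * l)%:Z + 1 - p%:Z else p%:Z - 1 - (2 * l)%:Z
  else p%:Z - 1 - j%:Z)%R.

Lemma zigzag_range p j : 1 < p -> j <= p -> 0 < zigzag p j <= 2 * p.
Proof. by rewrite /zigzag => p_gt1 jp; do ?[case: ifP => ?]; lia. Qed.

Lemma zigzag_inj p i j : i < p -> j < p ->
  (zigzag p i = zigzag p j -> i = j) /\ zigzag p i + zigzag p j <> 2 * p + 1.
Proof.
by rewrite /zigzag => ip jp; split; do ?[case: ifP => ?]; lia.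
Qed.

Lemma zigzag_linkE p j : 1 < p -> j < p ->
  ((zigzag p j)%:Z + (zigzag p j.+1)%:Z = (2 * p)%:Z + 1 + zigzag_link p j)%R.
Proof.
by rewrite /zigzag /zigzag_link => p_gt1 jp; do ?[case: ifP => ?]; lia.
Qed.

Lemma zigzag_link_range p j : 1 < p -> j < p ->
  (- p%:Z <= zigzag_link p j <= p%:Z)%R.
Proof.
by rewrite /zigzag_link => p_gt1 jp; do ?[case: ifP => ?]; lia.
Qed.

Lemma zigzag_link_inj p i j : 1 < p -> i < p -> j < p ->
  (zigzag_link p i = zigzag_link p j -> i = j)
  /\ (zigzag_link p i + zigzag_link p j <> 0)%R.
Proof.
by rewrite /zigzag_link => p_gt1 ip jp; split; do ?[case: ifP => ?]; lia.
Qed.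

(** After [p] steps the circuit is back at its start, possibly with the opposite
    sign: it has one component of length 2p or two of length [p]. *)
Lemma zigzag_end p :
  zigzag p p = if p %% 4 < 2 then zigzag p 0 else 2 * p + 1 - zigzag p 0.
Proof. by rewrite /zigzag; do ?[case: ifP => ?]; lia. Qed.

Lemma eq_modn_double p x y : x < 2 * p -> y < 2 * p -> x = y %[mod p] ->
  x = y \/ x = y + p \/ y = x + p.
Proof.
have modE z : z < 2 * p -> z %% p = if z < p then z else z - p.
  move=> lez; case: ltnP => [|lepz]; first exact: modn_small.
  by rewrite -{1}(subnK lepz) modnDr modn_small //; lia.
by move=> ltx lty; rewrite !modE //; do 2!case: ifP => ?; lia.
Qed.

(** Steps of at most 2 from two positions of one block, in a cycle of [a] blocks
    of length [h], meet inside the block, unless there is only one block and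
    they run around the cycle. *)
Lemma eq_block_shift a h x y d e :
    0 < a -> 1 < h -> x < a * h -> y < a * h -> d < 3 -> e < 3 ->
    x %/ h = y %/ h -> x + d = y + e %[mod a * h] ->
  [\/ x + d = y + e /\ x %% h + d = y %% h + e,
      x %% h + d = y %% h + e + h | y %% h + e = x %% h + d + h].
Proof.
move=> a_gt0 h_gt1 ltx lty d3 e3 eq_q.
have ltr z : z %% h < h by rewrite ltn_mod; lia.
have [ltxh ltyh] := (ltr x, ltr y).
have p_gt1 : 1 < a * h by case: (a) a_gt0 => // a' _; rewrite mulSn; lia.
have [ltxd ltye] : x + d < 2 * (a * h) /\ y + e < 2 * (a * h) by lia.
move/(eq_modn_double ltxd ltye) => E.
have : x + y %% h = y + x %% h.
  by rewrite {1}(divn_eq x h) {2}(divn_eq y h) eq_q; lia.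
have : h = a * h \/ 2 * h <= a * h.
  by case: (a) a_gt0 => [|[|a']] // _; rewrite ?mulSn; [left|right]; lia.
move: (x %% h) (y %% h) (a * h) ltxh ltyh E p_gt1 {eq_q ltr ltx lty ltxd ltye} => i j p.
move=> lti ltj E p_gt1 hp xy; have [E'|[E'|E']] := E.
- by constructor 1; split=> //; lia.
- by constructor 2; lia.
- by constructor 3; lia.
Qed.

Definition side (p : nat) (s : bool) (x : int) : int :=
  (if s then x else (2 * p)%:Z + 1 - x)%R.

(** The entry [d] of the triple of vertex [(s, i)], when the vertices of positive
    sign are numbered by [u]. *)
Definition side_val p (u : nat -> nat) s i d : int :=
  link_val (2 * p) (side p s (u i)%:Z) (side p s (u i.+1)%:Z) d.

(** The rows of a block are described by [r], the same for all [a] blocks.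
    Different blocks have different rows, so rows and columns only have to be
    compared inside one block; the condition with [+ h] covers the case of a
    single block, whose end is adjacent to its beginning with either sign.
    The row sums have to vanish for any numbering [u]: they use nothing but the
    shape of the triples. *)
Lemma SMR_of_blocks (RB : finType) a h k (r : bool -> nat -> nat -> RB) :
    0 < a -> 1 < h -> #|RB| * k = 6 * h ->
    (forall s t i j d e, i < h -> j < h -> d < 3 -> e < 3 ->
       r s i d = r t j e ->
       (i + d = j + e -> s = t -> d = e) /\ i + d <> j + e + h) ->
    (forall q, \sum_(i < h) \sum_s \sum_(d < 3) (r s i d == q : nat) = k) ->
    (forall p u q, \sum_(i < h) \sum_s \sum_(d < 3)
       (if r s i d == q then side_val p u s i d else 0) = 0)%R ->
  exists_SMR (a * #|RB|) (2 * (a * h)) k 3.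
Proof.
move=> a_gt0 h_gt1 cardRB transv size_r sum_r; set p := a * h.
have p_gt1 : 1 < p by rewrite /p; nia.
have h_gt0 : 0 < h by lia.
have blk (j : 'I_p) : j %/ h < a by rewrite ltn_divLR.
pose flip := ~~ (p %% 4 < 2).
pose nxt (x : bool * 'I_p) := (x.1 (+) (x.2.+1 == p) && flip, ordS x.2).
pose c (x : bool * 'I_p) := side p x.1 (zigzag p x.2)%:Z%R.
pose row (x : bool * 'I_p) (d : nat) := (Ordinal (blk x.2), r x.1 (x.2 %% h) d).
have c_nxt x : c (nxt x) = side p x.1 (zigzag p x.2.+1)%:Z%R.
  case: x => s j; rewrite /c /nxt /=.
  have [jp|jp] := eqVneq j.+1 p; last first.
    by rewrite andFb addbF modn_small //; have := ltn_ord j; lia.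
  rewrite jp modnn zigzag_end /flip; have := zigzag_range p_gt1 (leq0n p).
  by case: (p %% 4 < 2) s => -[] //= ?; rewrite /side; lia.
have iter_pos d x : (iter d nxt x).2 = (x.2 + d) %% p :> nat.
  elim: d => [|d IHd] /=; first by rewrite addn0 modn_small.
  by rewrite IHd addnS -addn1 modnDml addn1.
have iter_sign d x : d < 3 -> (iter d nxt x).1 = x.1 (+) (p <= x.2 + d) && flip.
  case: x => s j; have ltjp := ltn_ord j.
  case: d => [|[|[|//]]] _ /=.
  - by rewrite addn0 leqNgt ltjp addbF.
  - by congr (_ (+) _ && _); lia.
  rewrite -addbA -andb_addl; congr (_ (+) _ && _).
  have [jp|jp] := eqVneq j.+1 p.
    by rewrite jp modnn; lia.
  by rewrite modn_small; lia.
apply: (@SMR_of_circuit (bool * 'I_p)%type ('I_a * RB)%type _ (2 * p) k nxt c row).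
- by rewrite card_prod card_ord.
- by rewrite card_prod card_bool card_ord.
- by rewrite -mulnA cardRB /p; lia.
- move=> [s i] [t j] eq_nxt; have ij : i = j := ordS_inj (congr1 snd eq_nxt).
  by move: (congr1 fst eq_nxt); rewrite /= ij => /addIb ->.
- move=> [s i] [t j]; rewrite /c /=.
  have [ij ij'] := zigzag_inj (ltn_ord i) (ltn_ord j).
  have [-> eq_ij|neq_st] := eqVneq s t.
    by congr (_, _); apply/val_inj/ij; move: eq_ij; rewrite /side; case: t; lia.
  by rewrite /side; case: s t neq_st => -[] //; lia.
- move=> [s j]; rewrite /c /=; have := zigzag_range p_gt1 (ltnW (ltn_ord j)).
  by rewrite /side; case: s; lia.
- move=> [s i] [t j]; rewrite !c_nxt /c /=.
  have := (zigzag_linkE p_gt1 (ltn_ord i)); have := (zigzag_linkE p_gt1 (ltn_ord j)).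
  have [ij ij'] := zigzag_link_inj p_gt1 (ltn_ord i) (ltn_ord j).
  move=> Ej Ei; have [-> eq_ij|neq_st] := eqVneq s t.
    by congr (_, _); apply/val_inj/ij; move: eq_ij; rewrite /side; case: t; lia.
  by rewrite /side; case: s t neq_st => -[] //; lia.
- move=> [s j]; rewrite c_nxt /c /=; have := zigzag_link_range p_gt1 (ltn_ord j).
  have := zigzag_linkE p_gt1 (ltn_ord j).
  by rewrite /side; case: s; lia.
- move=> [s j]; rewrite c_nxt /c /=.
  have [_] := zigzag_link_inj p_gt1 (ltn_ord j) (ltn_ord j).
  have := zigzag_linkE p_gt1 (ltn_ord j).
  by rewrite /side; case: s; lia.
- move=> [s i] [t j] d e d3 e3 [] /= qij rij eq_it.
  have := congr1 (fun x => val x.2) eq_it; rewrite /= !iter_pos /= => pos_eq.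
  have := congr1 fst eq_it; rewrite !iter_sign //= => sign_eq.
  have [T1 T2] := transv _ _ _ _ _ _ (ltn_pmod i h_gt0) (ltn_pmod j h_gt0) d3 e3 rij.
  have [_ T3] := transv _ _ _ _ _ _ (ltn_pmod j h_gt0) (ltn_pmod i h_gt0) e3 d3 (esym rij).
  have := eq_block_shift a_gt0 h_gt1 (ltn_ord i) (ltn_ord j) d3 e3 qij pos_eq.
  case=> [[ijde eq_mod]|/T2 //|/T3 //].
  by apply: T1 => //; move: sign_eq; rewrite ijde => /addIb.
- move=> [l q]; rewrite -[RHS](size_r q).
  rewrite -(pair_bigA _ (fun s (j : 'I_p) => \sum_(d < 3) (row (s, j) d == (l, q) : nat))).
  rewrite exchange_big /=.
  pose F (l' i j : nat) := \sum_s \sum_(d < 3) ((l' == l :> nat) && (r s i d == q) : nat).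
  transitivity (\sum_(j < a * h) F (j %/ h) (j %% h) j).
    by apply: eq_bigr => j _; apply: eq_bigr => s _; apply: eq_bigr => d _.
  rewrite (@sum_block _ a h l F (ltn_ord l)).
    by apply: eq_bigr => i _; rewrite /F eqxx.
  move=> l' i j /negPf neq_l; rewrite /F; apply: big1 => s _; apply: big1 => d _.
  by rewrite neq_l.
- move=> [l q]; rewrite -[RHS](sum_r p (fun i => zigzag p (l * h + i)) q).
  rewrite -(pair_bigA _ (fun s (j : 'I_p) => \sum_(d < 3)
    if row (s, j) d == (l, q) then link_val (2 * p) (c (s, j)) (c (nxt (s, j))) d else 0)%R).
  rewrite exchange_big /=.
  pose F (l' i j : nat) := (\sum_s \sum_(d < 3)
    if (l' == l :> nat) && (r s i d == q) then side_val p (zigzag p) s j d else 0)%R.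
  transitivity (\sum_(j < a * h) F (j %/ h)%N (j %% h)%N j)%R.
    apply: eq_bigr => j _; apply: eq_bigr => s _; apply: eq_bigr => d _.
    by rewrite c_nxt.
  rewrite (@sum_block _ a h l F (ltn_ord l)).
    by apply: eq_bigr => i _; rewrite /F eqxx /side_val addnS.
  move=> l' i j /negPf neq_l; rewrite /F; apply: big1 => s _; apply: big1 => d _.
  by rewrite neq_l.
Qed.

(** * Rows of opposite pairs: even k *)

(** A proper 3-colouring of the cycle of length [h], with [colour h h] repeating
    [colour h 0]. *)
Definition colour (h i : nat) : nat :=
  if i == h then 0 else if (i.+1 == h) && odd h then 2 else odd i.

Lemma colour_lt3 h i : colour h i < 3.
Proof. by rewrite /colour; do ?[case: ifP => ?]; lia. Qed.

Lemma colour_proper h i : 1 < h -> i < h -> colour h i != colour h i.+1.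
Proof. by rewrite /colour => h_gt1 ltih; do ?[case: ifP => ?]; lia. Qed.

(** The three entries of a triple get the three colours.  The lower entry of the
    triple at position [i + 1] and the upper entry of the one at position [i] for
    the opposite sign are opposite, and they get the same colour. *)
Definition paired_row (h : nat) (s : bool) (i d : nat) : 'I_3 :=
  inord match d with
        | 0 => colour h i
        | 1 => 3 - colour h i - colour h i.+1
        | _ => colour h i.+1
        end.

Lemma val_paired_row h s i d : 1 < h -> i < h ->
  paired_row h s i d = match d with
        | 0 => colour h i
        | 1 => 3 - colour h i - colour h i.+1
        | _ => colour h i.+1
        end :> nat.
Proof.
move=> h_gt1 ltih; rewrite inordK //.
have := (colour_lt3 h i); have := colour_lt3 h i.+1; have := colour_proper h_gt1 ltih.
by case: d => [|[|d]]; lia.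
Qed.

(** Summing over both signs, the lower entries at a position contribute
    [- (4 * p + 1)], the upper ones [4 * p + 1] and the middle ones 0, so the sum of
    a row telescopes around the block. *)
Lemma SMR_paired a h : 0 < a -> 1 < h ->
  exists_SMR (a * 3) (2 * (a * h)) (2 * h) 3.
Proof.
move=> a_gt0 h_gt1; rewrite -[in a * 3](card_ord 3).
apply: (SMR_of_blocks (r := paired_row h)) => //.
- by rewrite card_ord; lia.
- move=> s t i j d e ltih ltjh d3 e3 /(congr1 (@nat_of_ord 3)).
  rewrite !val_paired_row // => rij.
  have c0 : colour h h = colour h 0 by rewrite /colour; do ?[case: ifP => ?]; lia.
  have [h' hE] : exists h', h = h'.+2 by exists h.-2; lia.
  have proper l : l < h ->
      [&& colour h l != colour h l.+1, colour h l < 3 & colour h l.+1 < 3].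
    by move=> lth; rewrite colour_proper // !colour_lt3.
  split=> [ijde _|ijde]; last first.
    have := proper 0; have := proper h.-1; have := proper h.-2; rewrite hE /=.
    (* only the last two positions reach across the end, to the first two *)
    have [[iE jE]|[[iE jE]|[iE jE]]] :
      (i = h' /\ j = 0) \/ (i = h'.+1 /\ j = 0) \/ (i = h'.+1 /\ j = 1) by lia.
    1-3: subst; move: rij ijde c0;
      case: d e d3 e3 => [|[|[|//]]] [|[|[|//]]] _ _ /=; lia.
  have := proper i ltih; have := proper j ltjh.
  have := proper i.+1; have := proper j.+1; move: rij.
  have [//|[iE|[iE|[iE|iE]]]] : d = e \/ i = j.+1 \/ i = j.+2 \/ j = i.+1 \/ j = i.+2 by lia.
  1-4: subst; move: ijde;
    case: d e d3 e3 => [|[|[|//]]] [|[|[|//]]] _ _ /=; lia.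
- move=> q; transitivity (\sum_(i < h) 2); last by rewrite sum_nat_const card_ord mulnC.
  apply: eq_bigr => i _; transitivity (\sum_(s : bool) 1).
    apply: eq_bigr => s _; rewrite !big_ord_recl big_ord0 /= -!val_eqE /=.
    rewrite !val_paired_row //=; have := colour_proper h_gt1 (ltn_ord i).
    have := colour_lt3 h i; have := colour_lt3 h i.+1; have := ltn_ord q.
    by do 3!case: eqP => /= ?; lia.
  by rewrite big_bool.
- move=> p u q.
  pose K : int := (4 * p + 1)%N%:Z.
  pose f i : int := if colour h i == q then K else 0%R.
  transitivity (\sum_(0 <= i < h) (f i.+1 - f i))%R.
    rewrite big_mkord; apply: eq_bigr => i _.
    rewrite big_bool /= !big_ord_recl !big_ord0 /= -!val_eqE /=.
    rewrite !val_paired_row // /f /K /side_val /link_val /side /=.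
    by do 3!case: ifP => _; lia.
  rewrite telescope_sumr // /f; have -> : colour h h = colour h 0; last exact: subrr.
  by rewrite /colour; do ?[case: ifP => ?]; lia.
Qed.

(** * Blocks of six rows: odd k and an even number of entries *)

Section SixRows.

Variables (B : nat) (tab : bool -> seq (seq nat)) (rho : bool -> seq nat).

(** The first [B] positions of a block follow the table [tab].  From there on a
    triple is kept whole, and the triples of sign [s] are dealt to the three rows
    of [rho s] in turn. *)
Definition six_row (s : bool) (i d : nat) : nat :=
  if i < B then nth 0 (nth [::] (tab s) i) d else nth 0 (rho s) ((i - B) %% 3).

(** The conditions of [SMR_of_blocks] on [six_row] are periodic of period 3 from
    position [B] on, which leaves finitely many positions to inspect. *)
Definition six_bounded : bool :=
  all (fun s => all (fun i => all (fun d => six_row s i d < 6) (iota 0 3))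
                    (iota 0 (B + 3))) [:: true; false].

Definition six_transversal : bool :=
  all (fun s => all (fun i => all (fun j => all (fun d => all (fun e =>
    (i + d == j + e) && (six_row s i d == six_row s j e) ==> (d == e))
    (iota 0 3)) (iota 0 3)) (iota 0 (B + 5))) (iota 0 (B + 5))) [:: true; false].

(** For a single block of length [k], its last triples run into its first
    columns, with the same or with the opposite sign. *)
Definition six_closed (k : nat) : bool :=
  all (fun s => all (fun t => all (fun i => all (fun j => all (fun d => all (fun e =>
    (i + d == j + e + k) ==> (six_row s i d != six_row t j e))
    (iota 0 3)) (iota 0 3)) (iota 0 k)) (iota 0 k)) [:: true; false]) [:: true; false].

Lemma six_rowD3 s i d : B <= i -> six_row s (i + 3) d = six_row s i d.
Proof.
move=> leBi; rewrite /six_row !ifF; [|lia..].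
by rewrite addnC -addnBA // modnDl.
Qed.

Lemma six_row_shift s i d n : B <= i -> six_row s (i + 3 * n) d = six_row s i d.
Proof.
move=> leBi; elim: n => [|n IHn]; first by rewrite muln0 addn0.
by rewrite mulnS addnCA addnC six_rowD3 ?IHn //; lia.
Qed.

Lemma six_row_reduce i :
  exists n i0, [/\ i = i0 + 3 * n, i0 < B + 3 & (0 < n -> B <= i0)].
Proof.
have [ltiB|leBi] := ltnP i B; first by exists 0, i; split=> //; lia.
exists ((i - B) %/ 3), (B + (i - B) %% 3).
by have := divn_eq (i - B) 3; have := ltn_pmod (i - B) (isT : 0 < 3); split; lia.
Qed.

Lemma six_row_lt6 s i d : six_bounded -> d < 3 -> six_row s i d < 6.
Proof.
move=> /allP bnd d3; have [n [i0 [-> lti0 Bi0]]] := six_row_reduce i.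
have -> : six_row s (i0 + 3 * n) d = six_row s i0 d.
  by case: n Bi0 => [|n] Bi0; rewrite ?muln0 ?addn0 // six_row_shift // Bi0.
have /bnd/allP/(_ i0) : s \in [:: true; false] by case: (s).
by rewrite mem_iota => /(_ lti0)/allP/(_ d); rewrite mem_iota; apply.
Qed.

Lemma six_rowP s i j d e : six_transversal -> d < 3 -> e < 3 ->
  six_row s i d = six_row s j e -> i + d = j + e -> d = e.
Proof.
move=> /allP trv; wlog leij : i j d e / i <= j => [IH d3 e3 E ijde|d3 e3].
  by have [/IH|/ltnW/IH H] := leqP i j; [apply|apply/esym/H].
have [n [i0 [iE lti0 Bi0]]] := six_row_reduce i.
have [j0 jE] : exists j0, j = j0 + 3 * n by exists (j - 3 * n); lia.
have -> : six_row s i d = six_row s i0 d.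
  by rewrite iE; case: n Bi0 {iE jE} => [|n] Bi0; rewrite ?muln0 ?addn0 // six_row_shift // Bi0.
have -> : six_row s j e = six_row s j0 e.
  rewrite jE; case: n Bi0 iE jE => [|n] Bi0 iE jE; rewrite ?muln0 ?addn0 // six_row_shift //.
  by have := Bi0 isT; lia.
move=> E ijde.
have /trv/allP/(_ i0) : s \in [:: true; false] by case: (s).
rewrite mem_iota => /(_ ltac:(lia))/allP/(_ j0).
rewrite mem_iota => /(_ ltac:(lia))/allP/(_ d).
rewrite mem_iota => /(_ d3)/allP/(_ e).
rewrite mem_iota => /(_ e3); rewrite E eqxx andbT.
by have -> : i0 + d == j0 + e by [lia]; move/eqP.
Qed.

Lemma six_row_closed T : (0 < T -> six_closed (B + 3)) -> (T = 0 -> six_closed B) ->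
  forall s t i j d e, i < B + 3 * T -> j < B + 3 * T -> d < 3 -> e < 3 ->
  1 < B ->
  i + d = j + e + (B + 3 * T) -> six_row s i d <> six_row t j e.
Proof.
move=> closed1 closed0 s t i j d e lti ltj d3 e3 B_gt1 ijde.
have use k i0 : six_closed k -> i0 < k -> j < k -> i0 + d = j + e + k ->
    six_row s i0 d <> six_row t j e.
  move=> /allP cl lti0 ltjk E; apply/eqP.
  have /cl/allP/(_ t) : s \in [:: true; false] by case: (s).
  have tin : t \in [:: true; false] by case: (t).
  move=> /(_ tin)/allP/(_ i0); rewrite mem_iota => /(_ lti0)/allP/(_ j).
  rewrite mem_iota => /(_ ltjk)/allP/(_ d); rewrite mem_iota => /(_ d3)/allP/(_ e).
  by rewrite mem_iota E eqxx; apply.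
case: T closed1 closed0 lti ltj ijde => [|T] closed1 closed0 lti ltj ijde.
  by apply: (use B); [apply: closed0|lia..].
have -> : i = i - 3 * T + 3 * T by lia.
by rewrite six_row_shift; [apply: (use (B + 3)); [apply: closed1|lia..]|lia].
Qed.

Lemma six_row_tail s i d : six_row s (B + i) d = nth 0 (rho s) (i %% 3).
Proof. by rewrite /six_row ifF ?addKn //; lia. Qed.

(** Each further group of three positions adds one whole triple to each of the
    six rows, so the row sizes and row sums only have to be checked on the
    table. *)
Lemma SMR_six_rows b T :
    0 < b -> 1 < B -> six_bounded -> six_transversal ->
    (0 < T -> six_closed (B + 3)) -> (T = 0 -> six_closed B) ->
    (forall q, q < 6 ->
       \sum_(i < B) \sum_s \sum_(d < 3) (six_row s i d == q : nat) = B) ->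
    (forall q, q < 6 -> \sum_s \sum_(j < 3) (nth 0 (rho s) j == q : nat) = 1) ->
    (forall p u q, q < 6 -> (\sum_(i < B) \sum_s \sum_(d < 3)
       (if six_row s i d == q then side_val p u s i d else 0) = 0)%R) ->
  exists_SMR (b * 6) (2 * (b * (B + 3 * T))) (B + 3 * T) 3.
Proof.
move=> b_gt0 B_gt1 bnd trv cl1 cl0 tab_size rho_size tab_sum.
pose r s i d : 'I_6 := inord (six_row s i d).
have rE s i (d : nat) (q : 'I_6) : d < 3 -> (r s i d == q) = (six_row s i d == q).
  by move=> d3; rewrite -val_eqE /= inordK ?six_row_lt6.
rewrite -[in b * 6](card_ord 6); apply: (SMR_of_blocks (r := r)) => //.
- by lia.
- by rewrite card_ord.
- move=> s t i j d e lti ltj d3 e3 /(congr1 (@nat_of_ord 6)).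
  rewrite !inordK ?six_row_lt6 // => rij; split=> [ijde st|ijde].
    by rewrite st in rij; exact: (six_rowP trv d3 e3 rij ijde).
  exact: (six_row_closed cl1 cl0 lti ltj d3 e3 B_gt1 ijde rij).
- move=> q.
  transitivity (\sum_(i < B + 3 * T) \sum_s \sum_(d < 3) (six_row s i d == q : nat)).
    apply: eq_bigr => i _; apply: eq_bigr => s _; apply: eq_bigr => d _.
    by rewrite rE.
  rewrite big_split_ord /= tab_size //; congr (_ + _).
  rewrite mulnC (@sum_blocks nat T 3
    (fun i => \sum_s \sum_(d < 3) (six_row s (B + i) d == q : nat))).
  rewrite -[X in _ = X * 3]card_ord -sum_nat_const; apply: eq_bigr => l _.
  transitivity (\sum_s \sum_(j < 3) 3 * (nth 0 (rho s) j == q)).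
    rewrite exchange_big; apply: eq_bigr => s _; apply: eq_bigr => j _.
    under eq_bigr do rewrite six_row_tail modnMDl modn_small //.
    by rewrite sum_nat_const card_ord.
  under eq_bigr do rewrite -big_distrr.
  by rewrite -big_distrr /= rho_size.
- move=> p u q.
  transitivity (\sum_(i < B + 3 * T) \sum_s \sum_(d < 3)
     (if six_row s i d == q then side_val p u s i d else 0))%R.
    apply: eq_bigr => i _; apply: eq_bigr => s _; apply: eq_bigr => d _.
    by rewrite rE.
  rewrite big_split_ord /= tab_sum // add0r.
  apply: big1 => i _; apply: big1 => s _.
  rewrite !big_ord_recl big_ord0 /= !six_row_tail; case: eqP => _ //.
  by rewrite addr0 addrA link_val_sum.
Qed.

End SixRows.

(** Item [i] lists the rows of the lower, middle and upper entry of the triple at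
    position [i].  With four positions the rows do not depend on the sign, and
    each row has two entries of each sign: either as many lower as upper ones,
    or middle ones only. *)
Definition four_rows (s : bool) : seq (seq nat) :=
  [:: [:: 0; 4; 0]; [:: 1; 3; 5]; [:: 5; 4; 1]; [:: 2; 3; 2]].

Definition four_tail (s : bool) : seq nat :=
  if s then [:: 0; 1; 2] else [:: 4; 3; 5].

(** Rows 0, 2, 3, 5 hold a whole triple and an opposite pair.  Rows 4 and 1 hold
    the lower entry of position 1, the middle entries of positions 1, 2, 3 with
    alternating signs and the upper entry of position 3, and the opposites:
    these sums telescope. *)
Definition five_rows (s : bool) : seq (seq nat) :=
  if s then [:: [:: 0; 0; 0]; [:: 4; 4; 5]; [:: 3; 1; 0]; [:: 2; 4; 4]; [:: 2; 2; 2]]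
  else [:: [:: 3; 3; 3]; [:: 1; 1; 3]; [:: 5; 4; 2]; [:: 0; 1; 1]; [:: 5; 5; 5]].

Definition five_tail (s : bool) : seq nat :=
  if s then [:: 0; 1; 2] else [:: 3; 4; 5].

Lemma SMR_six_rows4 b T : 0 < b -> 0 < T ->
  exists_SMR (b * 6) (2 * (b * (4 + 3 * T))) (4 + 3 * T) 3.
Proof.
move=> b_gt0 T_gt0.
have bnd : six_bounded 4 four_rows four_tail by vm_compute.
have trv : six_transversal 4 four_rows four_tail by vm_compute.
have cl : six_closed 4 four_rows four_tail 7 by vm_compute.
have cl0 : T = 0 -> six_closed 4 four_rows four_tail 4.
  by move=> T0; rewrite T0 in T_gt0.
apply: (SMR_six_rows b_gt0 _ bnd trv (fun=> cl) cl0) => //.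
- do 6?[case=> //] => _;
  by rewrite !big_ord_recl !big_ord0 !big_bool /= !big_ord_recl !big_ord0.
- by do 6?[case=> //] => _; rewrite !big_bool /= !big_ord_recl !big_ord0.
- move=> p u; do 6?[case=> //] => _;
  rewrite !big_ord_recl !big_ord0 !big_bool /= !big_ord_recl !big_ord0 /=;
  rewrite /side_val /link_val /side /=; ring.
Qed.

Lemma SMR_six_rows5 b T : 0 < b ->
  exists_SMR (b * 6) (2 * (b * (5 + 3 * T))) (5 + 3 * T) 3.
Proof.
move=> b_gt0.
have bnd : six_bounded 5 five_rows five_tail by vm_compute.
have trv : six_transversal 5 five_rows five_tail by vm_compute.
have cl8 : six_closed 5 five_rows five_tail 8 by vm_compute.
have cl5 : six_closed 5 five_rows five_tail 5 by vm_compute.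
apply: (SMR_six_rows (T := T) b_gt0 _ bnd trv (fun=> cl8) (fun=> cl5)) => //.
- do 6?[case=> //] => _;
  by rewrite !big_ord_recl !big_ord0 !big_bool /= !big_ord_recl !big_ord0.
- by do 6?[case=> //] => _; rewrite !big_bool /= !big_ord_recl !big_ord0.
- move=> p u; do 6?[case=> //] => _;
  rewrite !big_ord_recl !big_ord0 !big_bool /= !big_ord_recl !big_ord0 /=;
  rewrite /side_val /link_val /side /=; ring.
Qed.

(** * Blowing up a rectangle with three rows *)

Section BlowUp.
Local Open Scope ring_scope.

(** A Kotzig array: three enumerations of the integers from [- g] to [g] whose
    termwise sum is 0. *)
Definition kotzig (g c u : nat) : int :=
  match c with
  | 0 => if odd u then g%:Z - u./2%:Z else - u./2%:Z
  | 1 => u%:Z - g%:Z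
  | _ => if odd u then - u./2%:Z - 1 else g%:Z - u./2%:Z
  end.

Lemma kotzig_sum g u : kotzig g 0 u + kotzig g 1 u + kotzig g 2 u = 0.
Proof. by rewrite /kotzig; case: ifP => ?; lia. Qed.

Lemma kotzig_range g c u : (u <= 2 * g)%N -> - g%:Z <= kotzig g c u <= g%:Z.
Proof. by move=> le_u; case: c => [|[|c]] /=; do ?[case: ifP => ?]; lia. Qed.

Lemma kotzig_inj g c u v : (u <= 2 * g)%N -> (v <= 2 * g)%N ->
  kotzig g c u = kotzig g c v -> u = v.
Proof. by move=> le_u le_v; case: c => [|[|c]] /=; do ?[case: ifP => ?]; lia. Qed.

(** In the first three columns the three enumerations form a Latin square, so
    they cancel in every row and in every column; the other columns
    cancel in pairs of opposites. *)
Definition fine (g r v u : nat) : int :=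
  if (v < 3)%N then kotzig g (nth 0%N [:: 0; 1; 2; 0; 1]%N (v + r)) u
  else if odd v then kotzig g r u else - kotzig g r u.

Lemma fine_range g r v u : (u <= 2 * g)%N -> - g%:Z <= fine g r v u <= g%:Z.
Proof.
move=> le_u; rewrite /fine; have := kotzig_range r le_u.
by have := kotzig_range (nth 0%N [:: 0; 1; 2; 0; 1]%N (v + r)) le_u; do ?[case: ifP => ?]; lia.
Qed.

Lemma fine_inj g r v u w : (u <= 2 * g)%N -> (w <= 2 * g)%N ->
  fine g r v u = fine g r v w -> u = w.
Proof.
move=> le_u le_w; rewrite /fine; case: ifP => _; first exact: kotzig_inj.
by case: ifP => _; [|move/oppr_inj]; apply: kotzig_inj.
Qed.

Lemma fine_col g v u : fine g 0 v u + fine g 1 v u + fine g 2 v u = 0.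
Proof.
have := kotzig_sum g u; rewrite /fine; move: (kotzig g) => f.
by case: v => [|[|[|v]]] /=; try case: ifP => _; lia.
Qed.

Lemma fine_row g r q u : (r < 3)%N -> \sum_(v < 3 + 2 * q) fine g r v u = 0.
Proof.
move=> r3; rewrite big_split_ord /= mulnC.
rewrite (@sum_blocks _ q 2 (fun v => fine g r (3 + v) u)) [X in _ + X]big1 => [|l _].
  have := kotzig_sum g u; rewrite !big_ord_recl big_ord0 /fine.
  move: (kotzig g) => f; rewrite /= !addr0.
  by case: r r3 => [|[|[|//]]] _; rewrite /bump /=; lia.
rewrite !big_ord_recl big_ord0 /fine /= /bump /= addn0 addn1 !addnS !add0n.
by rewrite /= muln2 odd_double /=; lia.
Qed.

(** The entry [E r v] of a 3 by [2 * q + 1] rectangle is replaced by the [2 * g + 1]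
    integers closest to [(2 * g + 1) * E r v], one in each of [2 * g + 1] copies of the
    rectangle; [fine] distributes them so that each copy has zero sums. *)
Lemma SMR_blow_up g q (E : nat -> nat -> int) :
    (0 < q)%N ->
    (forall r s v w, (r < 3)%N -> (s < 3)%N -> (v < 2 * q + 1)%N ->
       (w < 2 * q + 1)%N -> E r v = E s w -> r = s /\ v = w) ->
    (forall r v, (r < 3)%N -> (v < 2 * q + 1)%N ->
       - (3 * q + 1)%N%:Z <= E r v <= (3 * q + 1)%N%:Z) ->
    (forall v, (v < 2 * q + 1)%N -> E 0 v + E 1 v + E 2 v = 0) ->
    (forall r, (r < 3)%N -> \sum_(v < 2 * q + 1) E r v = 0) ->
  exists_SMR (3 * (2 * g + 1)) ((2 * q + 1) * (2 * g + 1)) (2 * q + 1) 3.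
Proof.
move=> q_gt0 inj_E E_range E_col E_row.
set a := (2 * g + 1)%N; set k := (2 * q + 1)%N.
have leg (u : 'I_a) : (u <= 2 * g)%N by have := ltn_ord u; rewrite /a; lia.
pose val (x : 'I_3 * 'I_a * 'I_k) := a%:Z * E x.1.1 x.2 + fine g x.1.1 x.2 x.1.2.
apply: (@SMR_of_cells _ ('I_3 * 'I_a)%type ('I_k * 'I_a)%type _ _ _ _
         fst (fun x => (x.2, x.1.2)) val).
- by rewrite card_prod !card_ord.
- by rewrite card_prod !card_ord.
- by move=> [[r u] v] [[s w] t] /= [-> _] [-> ->].
- move=> [[r u] v] [[s w] t]; rewrite /val /= => eq_val.
  (* two fine parts differ by less than the scaling factor *)
  have eqE : E r v = E s t.
    have := fine_range r v (leg u); have := fine_range s t (leg w).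
    move: (E r v) (E s t) (fine _ _ _ _) (fine _ _ _ _) eq_val.
    by rewrite /a => x y f f'; nia.
  have [rs vt] := inj_E _ _ _ _ (ltn_ord r) (ltn_ord s) (ltn_ord v) (ltn_ord t) eqE.
  move: eq_val; rewrite eqE rs vt => /addrI/(fine_inj (leg u) (leg w)) uw.
  by congr (_, _, _); apply: val_inj.
- move=> [[r u] v]; rewrite /val /smr_entries /=.
  have -> : (3 * a * k = 2 * (a * (3 * q + 1) + g) + 1)%N by rewrite /a /k; ring.
  have := fine_range r v (leg u); have := E_range _ _ (ltn_ord r) (ltn_ord v).
  move: (E r v) (fine _ _ _ _) => x f; rewrite ifT; last by lia.
  by nia.
- move=> r; rewrite -(pair_bigA _ (fun i (v : 'I_k) => (i == r : nat))) /=.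
  rewrite (bigD1 r) //= eqxx sum_nat_const card_ord muln1 big1 ?addn0 // => i /negPf neq.
  by rewrite neq big1.
- move=> [v u].
  rewrite -(pair_bigA _ (fun (i : 'I_3 * 'I_a) (t : 'I_k) =>
    ((t, i.2) == (v, u) : nat))) /=.
  rewrite -(pair_bigA _ (fun (r : 'I_3) (w : 'I_a) =>
    \sum_(t : 'I_k) ((t, w) == (v, u) : nat))%N) /=.
  rewrite (eq_bigr (fun=> 1%N)) ?sum_nat_const ?card_ord // => r _.
  rewrite (pair_bigA _ (fun (w : 'I_a) (t : 'I_k) => ((t, w) == (v, u) : nat))) /=.
  rewrite (bigD1 (u, v)) //= eqxx big1 // => -[w t]; apply: contraNeq.
  by rewrite eqb0 negbK => /= /eqP[-> ->].
- move=> [r u]; rewrite big_mkcond.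
  rewrite -(pair_bigA _ (fun i (v : 'I_k) =>
    if i == (r, u) then val (i, v) else 0)) /=.
  rewrite (bigD1 (r, u)) //= eqxx [X in _ + X]big1 ?addr0.
    rewrite big_split /= -big_distrr /= E_row // mulr0 add0r /k.
    have -> : (2 * q + 1 = 3 + 2 * q.-1)%N by lia.
    exact: fine_row.
  by move=> i /negPf neq; rewrite neq big1.
- move=> [v u]; rewrite big_mkcond.
  rewrite -(pair_bigA _ (fun (i : 'I_3 * 'I_a) (t : 'I_k) =>
    if (t, i.2) == (v, u) then val (i, t) else 0)) /=.
  rewrite -(pair_bigA _ (fun (r : 'I_3) (w : 'I_a) =>
    \sum_(t : 'I_k) if (t, w) == (v, u) then val (r, w, t) else 0)) /=.
  transitivity (\sum_(r < 3) val (r, u, v)).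
    apply: eq_bigr => r _.
    rewrite (pair_bigA _ (fun (w : 'I_a) (t : 'I_k) =>
      if (t, w) == (v, u) then val (r, w, t) else 0)) /=.
    rewrite (bigD1 (u, v)) //= eqxx big1 ?addr0 // => -[w t] neq.
    by case: eqP => // -[tv wu]; rewrite tv wu eqxx in neq.
  have := E_col v (ltn_ord v); have := fine_col g v u.
  rewrite !big_ord_recl big_ord0 /val /= /bump /= => f0 e0.
  transitivity (a%:Z * (E 0 v + E 1 v + E 2 v) + (fine g 0 v u + fine g 1 v u + fine g 2 v u)).
    by rewrite addr0; ring.
  by rewrite f0 e0 mulr0 addr0.
Qed.

End BlowUp.

(** * Rectangles with three rows *)

Section ThreeRows.
Local Open Scope ring_scope.

(** Column [v] consists of the numbers [layer q c v] for [c < 3]: a Kotzig array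
    with the first enumeration lowered and the last one raised by the length
    [2 * q + 1].  Columns [v] and [2 * q - v] are opposite. *)
Definition layer (q c v : nat) : int :=
  (2 * q + 1)%N%:Z * (c%:Z - 1) + kotzig q c v.

(** The order of column [v] from top to bottom.  Opposite columns are usually
    arranged so that they cancel in each row.  The middle column is
    [0, - w, w] for some [w]; the difference [layer q 1 v - layer q 0 v] is [w] at
    [v = q] and drops to [w - 3], [w - 6], [w - 9] at [v = q - 2], [q - 4], [q - 6].
    Since [w = (w - 3) + (w - 6) - (w - 9)], exchanging two entries in the
    columns at distance 2, 4 and 6 from the middle balances the rows. *)
Definition arrangement (q v : nat) : seq nat :=
  (if v == q then [:: 1; 0; 2]
  else if (v + 2 == q) || (v + 4 == q) then [:: 2; 1; 0]
  else if (v == q + 2) || (v == q + 4) then [:: 0; 2; 1]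
  else if v + 6 == q then [:: 2; 0; 1]
  else if v == q + 6 then [:: 0; 1; 2]
  else if v < q then [:: 0; 1; 2]
  else [:: 2; 1; 0])%N.

Definition three_rows (q r v : nat) : int :=
  layer q (nth 0%N (arrangement q v) r) v.

Lemma arrangement_perm q v : perm_eq (arrangement q v) [:: 0; 1; 2]%N.
Proof. by rewrite /arrangement; do ?[case: ifP => _]. Qed.

Lemma arrangement_lt3 q v r : (r < 3)%N -> (nth 0 (arrangement q v) r < 3)%N.
Proof.
move=> r3; have size3 := perm_size (arrangement_perm q v).
have : nth 0%N (arrangement q v) r \in arrangement q v by rewrite mem_nth ?size3.
by rewrite (perm_mem (arrangement_perm q v)) !inE; lia.
Qed.

Lemma three_rows_inj q r s v w : (r < 3)%N -> (s < 3)%N ->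
  (v < 2 * q + 1)%N -> (w < 2 * q + 1)%N ->
  three_rows q r v = three_rows q s w -> r = s /\ v = w.
Proof.
move=> r3 s3 ltv ltw; rewrite /three_rows.
have c3 := arrangement_lt3 q v r3; have d3 := arrangement_lt3 q w s3.
move=> eq_layer.
have [cd vw] : nth 0%N (arrangement q v) r = nth 0%N (arrangement q w) s /\ v = w.
  move: eq_layer c3 d3; move: (nth _ _ r) (nth _ _ s) => c d.
  have lev : (v <= 2 * q)%N by lia.
  have lew : (w <= 2 * q)%N by lia.
  rewrite /layer => E c3 d3; have cd : c = d.
    have := kotzig_range c lev; have := kotzig_range d lew.
    by case: c d c3 d3 E => [|[|[|//]]] [|[|[|//]]] _ _; lia.
  by split=> //; move: E; rewrite cd => /addrI/(kotzig_inj lev lew).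
split=> //; apply/eqP; rewrite -(nth_uniq 0%N _ _ (s := arrangement q v)).
- by rewrite cd vw.
- by rewrite (perm_size (arrangement_perm q v)).
- by rewrite (perm_size (arrangement_perm q v)).
- by rewrite (perm_uniq (arrangement_perm q v)).
Qed.

Lemma three_rows_range q r v : (r < 3)%N -> (v < 2 * q + 1)%N ->
  - (3 * q + 1)%N%:Z <= three_rows q r v <= (3 * q + 1)%N%:Z.
Proof.
move=> r3 ltv; have lev : (v <= 2 * q)%N by lia.
rewrite /three_rows /layer; have := arrangement_lt3 q v r3.
move: (nth _ _ _) => c; have := kotzig_range c lev.
by case: c => [|[|[|//]]]; lia.
Qed.

Lemma three_rows_col q v :
  three_rows q 0 v + three_rows q 1 v + three_rows q 2 v = 0.
Proof.
have := kotzig_sum q v; rewrite /three_rows /layer; move: (kotzig q) => f.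
by rewrite /arrangement; do ?[case: ifP => _]; rewrite /=; lia.
Qed.

Lemma sum_mirror q (F : nat -> int) :
  \sum_(v < 2 * q + 1) F v = F q + \sum_(v < q) (F v + F (2 * q - v)%N).
Proof.
elim: q F => [|q IHq] F; first by rewrite muln0 big_ord1 big_ord0 addr0.
have -> : (2 * q.+1 + 1 = (2 * q + 1).+2)%N by lia.
rewrite big_ord_recl big_ord_recr /= (IHq (fun v => F (bump 0 v))).
rewrite [in RHS]big_ord_recl /= /bump /= add1n.
have -> : (1 + (2 * q + 1) = 2 * q.+1 - 0)%N by lia.
set S := \sum_(i < q) _; set S' := \sum_(i < q) _.
have -> : S = S'.
  by apply: eq_bigr => i _; congr (F _ + F _); have := ltn_ord i; lia.
lia.
Qed.

Lemma layer_mirror q c v : (c < 3)%N -> (v <= 2 * q)%N ->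
  layer q c (2 * q - v) = - layer q (2 - c) v.
Proof.
move=> c3 lev; rewrite /layer /kotzig.
by case: c c3 => [|[|[|//]]] _ /=; do ?[case: ifP => ?]; lia.
Qed.

Lemma three_rows_row q r : (6 <= q)%N -> (r < 3)%N ->
  \sum_(v < 2 * q + 1) three_rows q r v = 0.
Proof.
move=> q6 r3; rewrite sum_mirror.
have [j qE] : exists j, q = (j + 6)%N by exists (q - 6)%N; lia.
have mirror v l l' : (v <= 2 * q)%N -> arrangement q v = l ->
    arrangement q (2 * q - v) = l' -> all (fun c => c < 3)%N l' ->
    three_rows q r v + three_rows q r (2 * q - v)
    = layer q (nth 0%N l r) v - layer q (2 - nth 0%N l' r) v.
  move=> lev <- al' l'3; rewrite [X in _ + X]/three_rows layer_mirror ?al' //.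
  by apply/(all_nthP 0%N l'3); rewrite -al' (perm_size (arrangement_perm _ _)).
have cut (G : nat -> int) : \sum_(v < q) G v = \sum_(v < j + 6) G v by rewrite -qE.
rewrite (cut (fun v => three_rows q r v + three_rows q r (2 * q - v))).
(* the columns at distance more than 6 cancel in opposite pairs *)
rewrite big_split_ord /= big1 => [|v _]; last first.
  have ltv := ltn_ord v; rewrite (@mirror v [:: 0; 1; 2]%N [:: 2; 1; 0]%N) //.
  - by case: r r3 {mirror} => [|[|[|//]]] _; rewrite subrr.
  - by lia.
  - by rewrite /arrangement; do ?[case: ifP => //= ?]; lia.
  - by rewrite /arrangement; do ?[case: ifP => //= ?]; lia.
(* the six columns to the left of the middle, from the outermost inwards *)
rewrite !big_ord_recl big_ord0 /= /bump /=.
rewrite (@mirror _ [:: 2; 0; 1]%N [:: 0; 1; 2]%N) //;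
  [|by lia|by rewrite /arrangement; do ?[case: ifP => //= ?]; lia..].
rewrite (@mirror _ [:: 0; 1; 2]%N [:: 2; 1; 0]%N) //;
  [|by lia|by rewrite /arrangement; do ?[case: ifP => //= ?]; lia..].
rewrite (@mirror _ [:: 2; 1; 0]%N [:: 0; 2; 1]%N) //;
  [|by lia|by rewrite /arrangement; do ?[case: ifP => //= ?]; lia..].
rewrite (@mirror _ [:: 0; 1; 2]%N [:: 2; 1; 0]%N) //;
  [|by lia|by rewrite /arrangement; do ?[case: ifP => //= ?]; lia..].
rewrite (@mirror _ [:: 2; 1; 0]%N [:: 0; 2; 1]%N) //;
  [|by lia|by rewrite /arrangement; do ?[case: ifP => //= ?]; lia..].
rewrite (@mirror _ [:: 0; 1; 2]%N [:: 2; 1; 0]%N) //;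
  [|by lia|by rewrite /arrangement; do ?[case: ifP => //= ?]; lia..].
rewrite /three_rows /arrangement eqxx /layer /kotzig.
by case: r r3 {mirror} => [|[|[|//]]] _ /=; do ?[case: ifP => ?]; lia.
Qed.

End ThreeRows.

(** * Three rows of length 5, 7 and 11 *)

Section SmallTables.
Local Open Scope ring_scope.

Definition entry_at (L : seq (seq int)) (r v : nat) : int :=
  nth 0 (nth [::] L r) v.

(** The hypotheses of [SMR_blow_up], in decidable form. *)
Definition table_ok (q : nat) (L : seq (seq int)) : bool :=
  let E := entry_at L in let ks := iota 0 (2 * q + 1) in
  [&& all (fun r => all (fun s => all (fun v => all (fun w =>
        (E r v == E s w) ==> (r == s) && (v == w)) ks) ks) (iota 0 3)) (iota 0 3),
      all (fun r => all (fun v => `|E r v| <= (3 * q + 1)%N%:Z) ks) (iota 0 3),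
      all (fun v => E 0%N v + E 1%N v + E 2%N v == 0) ks
    & all (fun r => foldr +%R 0 [seq E r v | v <- ks] == 0) (iota 0 3)].

Lemma SMR_of_table g q L : (0 < q)%N -> table_ok q L ->
  exists_SMR (3 * (2 * g + 1)) ((2 * q + 1) * (2 * g + 1)) (2 * q + 1) 3.
Proof.
have mem n i : (i < n)%N -> i \in iota 0 n by rewrite mem_iota.
move=> q_gt0 /and4P[/allP inj /allP rng /allP cols /allP rows].
apply: (@SMR_blow_up g q (entry_at L)) => //.
- move=> r s v w /mem/inj/allP injr /mem/injr/allP injs /mem/injs/allP injv /mem/injv.
  by move=> /implyP E /eqP/E/andP[/eqP-> /eqP->].
- move=> r v /mem/rng/allP rngr /mem/rngr; lia.
- by move=> v /mem/cols/eqP.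
- move=> r /mem/rows/eqP sum0; rewrite -[RHS]sum0.
  rewrite -(big_mkord xpredT (entry_at L r)) /index_iota subn0 unlock.
  by elim: (iota _ _) {sum0} => //= v s ->.
Qed.

End SmallTables.

Definition table5 : seq (seq int) :=
  [:: [:: -7; -6; 3; 6; 4]; [:: 0; 1; 2; -2; -1]; [:: 7; 5; -5; -4; -3]]%R.

Definition table7 : seq (seq int) :=
  [:: [:: -7; -4; -1; -5; 8; 2; 7]; [:: -3; -2; -8; 5; 1; 4; 3];
      [:: 10; 6; 9; 0; -9; -6; -10]]%R.

Definition table11 : seq (seq int) :=
  [:: [:: -11; -6; -12; -7; -13; 8; 13; 7; 12; 4; 5];
      [:: -5; -4; -3; -2; -1; -8; 1; 2; 3; 6; 11];
      [:: 16; 10; 15; 9; 14; 0; -14; -9; -15; -10; -16]]%R.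

(** The tables replace the arrangement for the lengths [2 * q + 1 < 13], where the
    middle column has fewer than six columns on either side.  The length 9 is
    left to [SMR_cyclic]. *)
Lemma SMR_odd g q : 1 < q -> q != 4 ->
  exists_SMR (3 * (2 * g + 1)) ((2 * q + 1) * (2 * g + 1)) (2 * q + 1) 3.
Proof.
move=> q_gt1 q_neq4; have [q6|ltq6] := leqP 6 q.
  apply: (@SMR_blow_up g q (three_rows q)); first by lia.
  - exact: three_rows_inj.
  - exact: three_rows_range.
  - by move=> v _; apply: three_rows_col.
  - by move=> r; apply: three_rows_row.
have [->|[->|->]] : q = 2 \/ q = 3 \/ q = 5 by lia.
- by apply: (@SMR_of_table g 2 table5) => //; vm_compute.
- by apply: (@SMR_of_table g 3 table7) => //; vm_compute.
- by apply: (@SMR_of_table g 5 table11) => //; vm_compute.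
Qed.

(** * The characterization *)

Theorem theorem20 (m n k : nat)
  (hm : 3 <= m) (hmn : m <= n) (hk : 3 <= k) (hkn : k <= n) :
  exists_SMR m n k 3 <-> m * k = 3 * n.
Proof.
split=> [/SMR_count|mk3n]; first by rewrite [n * 3]mulnC.
have [/dvdnP[t kE]|n3k] := boolP (3 %| k).
  have nE : n = m * t by nia.
  by rewrite nE kE [t * 3]mulnC; apply: SMR_cyclic; nia.
have /dvdnP[a mE] : 3 %| m.
  have : 3 %| m * k by rewrite mk3n dvdn_mulr.
  by rewrite Euclid_dvdM // (negPf n3k) orbF.
have nE : n = a * k by nia.
have a_gt0 : 0 < a by nia.
have [kodd|keven] := boolP (odd k); last first.
  have kE : k = 2 * k./2 by lia.
  have -> : n = 2 * (a * k./2) by rewrite nE {1}kE mulnCA.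
  by rewrite mE [in X in exists_SMR _ _ X]kE; apply: SMR_paired; lia.
have [aodd|aeven] := boolP (odd a).
  have kE : k = 2 * k./2 + 1 by lia.
  have aE : a = 2 * a./2 + 1 by lia.
  rewrite mE nE mulnC [a * k]mulnC aE kE; apply: SMR_odd; first by lia.
  (* q = 4 would make k = 9 *)
  by apply: contraNneq n3k => k4; rewrite kE k4.
have aE : a = a./2 * 2 by lia.
have -> : m = a./2 * 6 by lia.
have -> : n = 2 * (a./2 * k) by rewrite nE {1}aE -mulnA mulnCA.
have b_gt0 : 0 < a./2 by lia.
have [T [kE|[T_gt0 kE]]] : exists T, k = 5 + 3 * T \/ (0 < T /\ k = 4 + 3 * T).
  have [k1|k2] : k %% 3 = 1 \/ k %% 3 = 2 by lia.
    by exists ((k - 4) %/ 3); right; lia.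
  by exists ((k - 5) %/ 3); left; lia.
- by rewrite kE; apply: SMR_six_rows5.
- by rewrite kE; apply: SMR_six_rows4.
Qed.
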